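(* Let $J=(\sqrt{-3}-1)/2$ and let $\mathbf c=(c_n)_{n\ge0}$ be defined by $\prod_{k\ge 0}(1+Jx^{3^k})=\sum_{n\ge 0}c_nx^n$ (equivalently $c_0=1$, $c_{3n}=c_n$, $c_{3n+1}=Jc_n$, $c_{3n+2}=0$ for $n\ge0$). Let $\mathbf s=(s_n)_{n\ge0}$ with $s_n=c_n+c_{n+1}$. For $n\ge1$, $p\ge0$ let $\Sigma_n^p=(s_{p+i+j-2})_{1\le i,j\le n}$ be the $n\times n$ Hankel matrix of $\mathbf s$ starting at index $p$, with determinant $|\Sigma_n^p|$, and $|\Sigma_0^p|=1$ by convention. Then for all $n\ge 0$: $$|\Sigma_0^0|=1,\quad |\Sigma_{3n}^0|=|\Sigma_n^0|,\quad |\Sigma_{3n+1}^0|=-J^2|\Sigma_n^0|,\quad |\Sigma_{3n+2}^0|=-J^2|\Sigma_{n+1}^0|,$$ and $$|\Sigma_0^1|=1,\quad |\Sigma_{3n}^1|=|\Sigma_n^1|,\quad |\Sigma_{3n+1}^1|=J|\Sigma_n^1|,\quad |\Sigma_{3n+2}^1|=|\Sigma_n^1|.$$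
   Context: For a sequence $\mathbf u=(u_k)_{k\ge0}$ of complex numbers, the $(p,n)$-order Hankel matrix is $(u_{p+i+j-2})_{1\le i,j\le n}$; its determinant of order $0$ is $1$ by convention. Note $J$ is a primitive cube root of unity. *)

(* Defs.v *)
From HB Require Import structures.
From mathcomp Require Import all_boot all_order all_algebra.

Set Implicit Arguments.
Unset Strict Implicit.
Unset Printing Implicit Defensive.

Import Order.TTheory GRing.Theory Num.Theory.
Local Open Scope ring_scope.

(* The field C of complex numbers is any numClosedFieldType (e.g. algC, or
   R[i] for R a real closed field); there sqrtC (- 3) is the square root of -3
   with nonnegative imaginary part. *)
Definition J (C : numClosedFieldType) : C := (sqrtC (- 3) - 1) / 2.

(* The identity \prod_(k >= 0) F k = \sum_(n >= 0) c n * x ^ n of formal power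
   series: every coefficient of the partial products is eventually constant,
   equal to the corresponding coefficient of the right-hand side. *)
Definition is_infinite_product (C : nzRingType) (F : nat -> {poly C})
    (c : nat -> C) : Prop :=
  forall n : nat, exists K : nat, forall m : nat, (K <= m)%N ->
    (\prod_(k < m) F k)`_n = c n.

Definition cantor_factor (C : numClosedFieldType) (k : nat) : {poly C} :=
  1 + J C *: 'X^(3 ^ k).

Definition sum_seq (C : nzRingType) (c : nat -> C) (n : nat) : C :=
  c n + c n.+1.

(* Indices start at 0 here, so the entry u_(p+i+j-2), 1 <= i, j <= n, becomes
   u (p + i + j). *)
Definition hankel (C : nzRingType) (u : nat -> C) (p n : nat) : 'M[C]_n :=
  \matrix_(i < n, j < n) u (p + i + j)%N.

(* Main.v *)
(* Write C0 n, C1 n, S0 n, S1 n for the determinants of order n of the Hankel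
   matrices of c and s starting at index 0 and 1. Sorting rows and columns by
   their residue modulo 3 turns each matrix into a 3 x 3 block matrix whose
   blocks are combinations of Hankel matrices of c, the coefficients being those
   of a symmetric 3 x 3 matrix over polynomials in the shift t. A block LDL^T
   factorization with pivots among 1, t, 1 + t, t (1 + t), up to scalars, writes
   the determinant as a monomial in C0, C1, S0, S1; the order of the residues is
   chosen so that multiplication by t only goes from a shorter block to a longer
   one. These factorizations give by induction C1 n * S0 n = (-1)^n and
   C0 (n+1) * S1 n = (-1)^n, which reduce the monomials to the claimed values. *)
Require Import Defs.
From mathcomp Require Import all_boot all_order all_algebra all_fingroup.
From mathcomp Require Import zify ring.

Set Implicit Arguments.
Unset Strict Implicit.
Unset Printing Implicit Defensive.

Import Order.TTheory GRing.Theory Num.Theory.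
Local Open Scope ring_scope.

(** * Block elimination and Hankel blocks modulo 3 *)

(** The multiplier [Q] is supplied instead of a quotient by [A], so elimination takes no inverse. *)
Lemma det_block_Schur (R : comNzRingType) (m n : nat) (A : 'M[R]_m)
    (B : 'M[R]_(m, n)) (Q : 'M[R]_(n, m)) (D : 'M[R]_n) :
  \det (block_mx A B (Q *m A) D) = \det A * \det (D - Q *m B).
Proof.
have -> : block_mx A B (Q *m A) D =
    block_mx 1%:M 0 Q 1%:M *m block_mx A B 0 (D - Q *m B).
  by rewrite mulmx_block !mul1mx !mul0mx !addr0 subrKC.
by rewrite det_mulmx det_lblock det_ublock !det1 !mul1r.
Qed.

(** One permutation acts on both rows and columns, so its sign occurs twice and cancels. *)
Lemma det_reindex (R : comNzRingType) (N : nat) (v : nat -> nat -> R)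
    (g : 'I_N -> nat) :
  injective g -> (forall k, (g k < N)%N) ->
  \det (\matrix_(i < N, j < N) v (g i) (g j)) =
  \det (\matrix_(i < N, j < N) v i j).
Proof.
move=> injg ltgN.
pose f k := Ordinal (ltgN k).
have injf : injective f by move=> i j /(congr1 val) /injg.
pose A : 'M[R]_N := \matrix_(i, j) v i j.
have -> : \matrix_(i, j) v (g i) (g j) =
    row_perm (perm injf) (col_perm (perm injf) A).
  by apply/matrixP=> i j; rewrite !mxE !permE.
rewrite row_permE col_permE !det_mulmx !det_perm odd_permV mulrCA.
by rewrite -signr_addb addbb mulr1.
Qed.

(* Multiplication by [x * t ^ e], from polynomials in [t] of degree less than
   [a] to polynomials of degree less than [b]. *)
Definition shift_mx (R : nzRingType) (x : R) (e a b : nat) : 'M[R]_(a, b) :=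
  \matrix_(i, j) (x *+ (nat_of_ord j == i + e)%N).

Definition hankel_rect (R : nzRingType) (v : nat -> R) (a b : nat) :
  'M[R]_(a, b) := \matrix_(i, j) v (i + j)%N.

(** The bound keeps row [i + e] inside the right factor, so truncation loses no term. *)
Lemma mul_shift_hankel_rect (R : nzRingType) (x : R) (e a b d : nat)
    (v : nat -> R) : (a + e <= b)%N ->
  shift_mx x e a b *m hankel_rect v b d =
  hankel_rect (fun m => x * v (m + e)%N) a d.
Proof.
move=> leb; apply/matrixP=> i j; rewrite !mxE.
have lti : (i + e < b)%N by have := ltn_ord i; lia.
rewrite (bigD1 (Ordinal lti)) //= big1 ?addr0 => [|k /eqP nek]; rewrite !mxE.
  by rewrite eqxx mulr1n addnAC.
by case: eqP => [eqk|_]; [case: nek; apply: val_inj | rewrite mulr0n mul0r].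
Qed.

Lemma det_hankel_rect (R : comNzRingType) (k : R) (u : nat -> R) (p n : nat) :
  \det (hankel_rect (fun m => k * u (p + m)%N) n n) =
  k ^+ n * \det (hankel u p n).
Proof.
by rewrite -detZ; congr (\det _); apply/matrixP=> i j; rewrite !mxE addnA.
Qed.

(* The hypotheses on [v] describe a block LDL^T factorization with pivots [w0],
   [w1], [w2] and multipliers [x t^e], [y t^f], [z t^g], where [t] is the shift;
   the bounds on the sizes [a], [b], [d] let the multipliers act on the
   truncated blocks. *)
Lemma det_hankel_mod3 (R : comNzRingType) (u w0 w1 w2 : nat -> R)
    (p N a b d r0 r1 r2 : nat) (x y z : R) (e f g : nat) :
  uniq [:: r0; r1; r2] -> all (ltn^~ 3) [:: r0; r1; r2] ->
  N = (a + (b + d))%N ->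
  (forall i, (i < a)%N -> (3 * i + r0 < N)%N) ->
  (forall i, (i < b)%N -> (3 * i + r1 < N)%N) ->
  (forall i, (i < d)%N -> (3 * i + r2 < N)%N) ->
  (b + e <= a)%N -> (d + f <= a)%N -> (d + g <= b)%N ->
  let v r s m := u (p + (r + s) + 3 * m)%N in
  (forall m, v r0 r0 m = w0 m) ->
  (forall m, v r1 r0 m = x * w0 (m + e)%N) ->
  (forall m, v r2 r0 m = y * w0 (m + f)%N) ->
  (forall m, v r1 r1 m = w1 m + x * v r0 r1 (m + e)%N) ->
  (forall m, v r2 r1 m = z * w1 (m + g)%N + x * v r2 r0 (m + e)%N) ->
  (forall m, v r2 r2 m = w2 m + z ^+ 2 * w1 (m + g + g)%N
                          + y * v r0 r2 (m + f)%N) ->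
  \det (hankel u p N) =
  \det (hankel_rect w0 a a) * \det (hankel_rect w1 b b) *
  \det (hankel_rect w2 d d).
Proof.
move=> uniqr ltr3 -> lta ltb ltd lea led lgd v v00 v10 v20 v11 v21 v22.
have vC r s m : v r s m = v s r m by rewrite /v [(s + r)%N]addnC.
(* The new order of indices: all of residue [r0], then [r1], then [r2]. *)
pose h (k : 'I_(a + (b + d))) : nat :=
  match split k with
  | inl i => (3 * i + r0)%N
  | inr k => match split k with inl i => (3 * i + r1)%N
             | inr i => (3 * i + r2)%N end
  end.
have hl i : h (lshift _ i) = (3 * i + r0)%N by rewrite /h (unsplitK (inl _)).
have hrl i : h (rshift _ (lshift _ i)) = (3 * i + r1)%N.
  by rewrite /h (unsplitK (inr _)) (unsplitK (inl _)).
have hrr i : h (rshift _ (rshift _ i)) = (3 * i + r2)%N.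
  by rewrite /h (unsplitK (inr _)) (unsplitK (inr _)).
have hlt k : (h k < a + (b + d))%N.
  rewrite /h; case: (split k) => [i|k']; first exact: lta.
  by case: (split k') => i; [apply: ltb | apply: ltd].
have hinj : injective h.
  move: uniqr ltr3; rewrite /= !inE !negb_or !andbT.
  move=> /andP[/andP[/eqP n01 /eqP n02] /eqP n12] /and3P[lt0 lt1 lt2].
  move=> k l; rewrite -(splitK k) -(splitK l).
  case: (split k) => [i|k1]; case: (split l) => [j|l1] /=;
    rewrite ?hl.
  - by move=> eqij; congr (lshift _ _); apply: val_inj => /=; lia.
  - by rewrite -(splitK l1); case: (split l1) => ? /=; rewrite ?hrl ?hrr; lia.
  - by rewrite -(splitK k1); case: (split k1) => ? /=; rewrite ?hrl ?hrr; lia.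
  rewrite -(splitK k1) -(splitK l1).
  case: (split k1) => i; case: (split l1) => j /=; rewrite ?hrl ?hrr => eqij;
    try lia; congr (rshift _ _).
  - by congr (lshift _ _); apply: val_inj => /=; lia.
  - by congr (rshift _ _); apply: val_inj => /=; lia.
have -> : hankel u p (a + (b + d)) = \matrix_(i, j) u (p + (i + j))%N.
  by apply/matrixP=> i j; rewrite !mxE -addnA.
rewrite -(det_reindex (fun i j => u (p + (i + j))%N) hinj hlt).
pose H r s a b := hankel_rect (v r s) a b.
have -> : \matrix_(i, j) u (p + (h i + h j))%N =
  block_mx (H r0 r0 a a) (row_mx (H r0 r1 a b) (H r0 r2 a d))
   (col_mx (shift_mx x e b a) (shift_mx y f d a) *m H r0 r0 a a)
   (block_mx (H r1 r1 b b) (H r1 r2 b d) (H r2 r1 d b) (H r2 r2 d d)).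
  rewrite mul_col_mx !mul_shift_hankel_rect //.
  apply/matrixP=> k l; rewrite -(splitK k) -(splitK l).
  have vE r s i j : u (p + (3 * i + r + (3 * j + s)))%N = v r s (i + j)%N.
    by rewrite /v; congr u; lia.
  case: (split k) => [i|k1]; case: (split l) => [j|l1] /=.
  - by rewrite block_mxEul !mxE !hl vE.
  - rewrite block_mxEur -(splitK l1); case: (split l1) => j /=.
      by rewrite row_mxEl !mxE hl hrl vE.
    by rewrite row_mxEr !mxE hl hrr vE.
  - rewrite block_mxEdl -(splitK k1); case: (split k1) => i /=.
      by rewrite col_mxEu !mxE hl hrl vE v10 v00.
    by rewrite col_mxEd !mxE hl hrr vE v20 v00.
  rewrite block_mxEdr -(splitK k1) -(splitK l1).
  case: (split k1) => i; case: (split l1) => j /=;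
    by rewrite ?(block_mxEul, block_mxEur, block_mxEdl, block_mxEdr) !mxE
        ?hrl ?hrr vE.
rewrite det_block_Schur mul_col_row -mulrA.
rewrite !mul_shift_hankel_rect // opp_block_mx add_block_mx.
have -> : H r0 r0 a a = hankel_rect w0 a a.
  by apply/matrixP=> i j; rewrite !mxE v00.
congr (_ * _).
set B11 := _ - _; set B12 := _ - _; set B21 := _ - _; set B22 := _ - _.
have E11 : B11 = hankel_rect w1 b b.
  by apply/matrixP=> i j; rewrite !mxE v11 addrK.
have E12 : B12 = hankel_rect (fun m => z * w1 (m + g)%N) b d.
  by apply/matrixP=> i j; rewrite !mxE vC v21 [v r0 r2 _]vC addrK.
(* Second elimination: x t^e and y t^f commute, so the terms in [w0] cancel and z t^g times the
   pivot [w1] remains. *)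
have E21 : B21 = shift_mx z g d b *m B11.
  rewrite E11 mul_shift_hankel_rect //; apply/matrixP=> i j; rewrite !mxE v21.
  by rewrite v20 [v r0 r1 _]vC v10 !(mulrCA y) (addnAC _ f) addrK.
rewrite E21 det_block_Schur E11 E12 mul_shift_hankel_rect //; congr (_ * \det _).
by apply/matrixP=> i j; rewrite !mxE v22; ring.
Qed.

(** * From the infinite product to the recurrence *)

Definition cantor_seq (R : nzRingType) (j : R) (c : nat -> R) : Prop :=
  [/\ forall n, c (3 * n)%N = c n,
      forall n, c (3 * n).+1 = j * c n
    & forall n, c (3 * n).+2 = 0].

(** A rewriting multirule up to offset 6: block entries have offset at most 1 + 2 + 2, and [sum_seq]
    adds one. *)
Lemma cantor_seqE (R : nzRingType) (j : R) (c : nat -> R) :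
  cantor_seq j c -> forall n,
  (c (3 * n)%N = c n) * (c (3 * n).+1 = j * c n) * (c (3 * n).+2 = 0) *
  (c (3 * n).+3 = c n.+1) * (c (3 * n).+4 = j * c n.+1) *
  (c (3 * n).+4.+1 = 0) * (c (3 * n).+4.+2 = c n.+2).
Proof.
case=> c0 c1 c2 n; have E m : (3 * m).+3 = (3 * m.+1)%N by lia.
by rewrite !E !(c0, c1, c2).
Qed.
(** The partial products satisfy F_{m+1}(x) = (1 + J x) F_m(x^3); coefficients are compared by
    residue of the exponent. *)
Lemma cantor_recurrence (C : numClosedFieldType) (c : nat -> C) :
  is_infinite_product (cantor_factor C) c ->
  c 0%N = 1 /\ cantor_seq (J C) c.
Proof.
move=> hc.
pose F m := \prod_(k < m) cantor_factor C k.
have FS m : F m.+1 = F m \Po 'X^3 + J C *: ((F m \Po 'X^3) * 'X).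
  have -> : F m \Po 'X^3 = \prod_(k < m) cantor_factor C k.+1.
    rewrite /F (big_morph _ (fun p q => comp_polyM p q 'X^3) (comp_polyC 1 _)).
    apply: eq_bigr => k _; rewrite /cantor_factor comp_polyD comp_polyZ.
    by rewrite comp_polyC comp_Xn_poly -exprM expnS.
  by rewrite /F big_ord_recl mulrDl mul1r -scalerAl mulrC.
(* Both coefficients are stable from [k] on; [k.+1] and [k] are taken to match [FS]. *)
have lim n m : exists k, c n = (F k.+1)`_n /\ c m = (F k)`_m.
  have [K1 h1] := hc n; have [K2 h2] := hc m.
  exists (maxn K1 K2); split; [rewrite h1 | rewrite h2] => //; lia.
have FE k n r : (r < 3)%N ->
    (F k \Po 'X^3)`_(3 * n + r) = (F k)`_n *+ (r == 0)%N.
  move=> r3; rewrite coef_comp_poly_Xn // dvdn_addr ?dvdn_mulr //.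
  case: r r3 => [|[|[]]] //= _.
  by rewrite addn0 mulKn.
split; last split=> n.
- have [K h] := hc 0%N; rewrite -(h K) // coef0_prod big1 // => k _.
  rewrite coefD coef1 coefZ coefXn.
  by rewrite [_ == (3 ^ k)%N]eq_sym expn_eq0 mulr0 addr0.
- have [k [-> ->]] := lim (3 * n)%N n.
  rewrite FS coefD coefZ coefMX -[(3 * n)%N]addn0 FE // eqxx mulr1n.
  (* For positive [n] the term J x F(x^3) reads F(x^3) at 3n - 1, of residue 2, where it
     vanishes. *)
  case: n => [|n]; first by rewrite mulr0 addr0.
  have -> : ((3 * n.+1 + 0).-1 = 3 * n + 2)%N by lia.
  by rewrite FE // addn0 muln_eq0 /= mulr0 addr0.
- rewrite -addn1; have [k [-> ->]] := lim (3 * n + 1)%N n.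
  by rewrite FS coefD coefZ coefMX FE // addn1 /= -[(3 * n)%N]addn0 FE // add0r.
rewrite -addn2; have [k [-> _]] := lim (3 * n + 2)%N n.
rewrite FS coefD coefZ coefMX FE // addn2 /= -[(3 * n).+1]addn1 FE //.
by rewrite mulr0 addr0.
Qed.

(** The minimal equation of a primitive cube root of unity, through which alone the value of [J]
    enters the determinants. *)
Lemma J_root (C : numClosedFieldType) : J C ^+ 2 = - J C - 1.
Proof.
have h : sqrtC (- 3 : C) ^+ 2 = - 3 by rewrite sqrtCK.
by rewrite /J; field: h.
Qed.

(** * Reductions modulo 3 of the four determinant families *)

Ltac mod3_blocks hj cE :=
  try (by []); try lia;
  try (move=> m; rewrite /= /sum_seq ?(addSn, add0n) ?cE ?(addn0, addn1);
       by ring: hj).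

(** The pivots carry the scalars 1, j, -j^2 in some order; since j (-j^2) = -1, the sign (-1)^n is
    split as j^n (-j^2)^n. *)
Ltac mod3_scalars E hj :=
  match type of E with ?a * ?b = (-1) ^+ ?n =>
    rewrite ?(exprS _ n) ?expr1n -E; move: a b => ? ?; ring: hj
  end.

(** Over residues 0, 1, 2 the matrix in the shift t is [[1, j, 0], [j, 0, t], [0, t, j t]]. *)
Lemma det_hankel_c0_mod3 (R : comNzRingType) (j : R) (c : nat -> R) (n : nat) :
  j ^+ 2 = - j - 1 -> cantor_seq j c ->
  let C0 n := \det (hankel c 0 n) in
  let C1 n := \det (hankel c 1 n) in
  let S0 n := \det (hankel (sum_seq c) 0 n) in
  let S1 n := \det (hankel (sum_seq c) 1 n) in
  [/\ C0 (3 * n)%N = (-1) ^+ n * (C0 n * C1 n * S0 n),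
      C0 (3 * n + 1)%N = (-1) ^+ n * (C0 n.+1 * C1 n * S0 n)
    & C0 (3 * n + 2)%N = - j ^+ 2 * (-1) ^+ n * (C0 n.+1 ^+ 2 * S1 n)].
Proof.
move=> hj hc C0 C1 S0 S1; have cE := cantor_seqE hc.
have E : j ^+ n * (- j ^+ 2) ^+ n = (-1) ^+ n.
  by rewrite -exprMn; congr (_ ^+ n); ring: hj.
rewrite {}/C0 {}/C1 {}/S0 {}/S1; split.
- rewrite (@det_hankel_mod3 _ c
    (fun m => 1 * c (0 + m)%N)
    (fun m => j * c (1 + m)%N)
    (fun m => - j ^+ 2 * sum_seq c (0 + m)%N)
    0 _ n n n 0 2 1 0 j (j ^+ 2) 0 0 0);
    mod3_blocks hj cE.
  by rewrite !det_hankel_rect; mod3_scalars E hj.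
- rewrite (@det_hankel_mod3 _ c
    (fun m => 1 * c (0 + m)%N)
    (fun m => j * c (1 + m)%N)
    (fun m => - j ^+ 2 * sum_seq c (0 + m)%N)
    0 _ n.+1 n n 0 2 1 0 j (j ^+ 2) 0 0 0);
    mod3_blocks hj cE.
  by rewrite !det_hankel_rect; mod3_scalars E hj.
(* Residue 2 is now the shortest block and goes last; the longer pivot block leaves room for the
   multiplier -j t. *)
- rewrite (@det_hankel_mod3 _ c
    (fun m => 1 * c (0 + m)%N)
    (fun m => - j ^+ 2 * c (0 + m)%N)
    (fun m => j * sum_seq c (1 + m)%N)
    0 _ n.+1 n.+1 n 0 1 2 j 0 (- j) 0 0 1);
    mod3_blocks hj cE.
  by rewrite !det_hankel_rect; mod3_scalars E hj.
Qed.

(** The matrix is [[j, 0, t], [0, t, j t], [t, j t, 0]]. For equal blocks no multiplier may contain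
    t, so the pivot t of residue 1 comes first. *)
Lemma det_hankel_c1_mod3 (R : comNzRingType) (j : R) (c : nat -> R) (n : nat) :
  j ^+ 2 = - j - 1 -> cantor_seq j c ->
  let C0 n := \det (hankel c 0 n) in
  let C1 n := \det (hankel c 1 n) in
  let S0 n := \det (hankel (sum_seq c) 0 n) in
  let S1 n := \det (hankel (sum_seq c) 1 n) in
  [/\ C1 (3 * n)%N = (-1) ^+ n * (C1 n ^+ 2 * S0 n),
      C1 (3 * n + 1)%N = j * (-1) ^+ n * (C0 n.+1 * C1 n * S1 n)
    & C1 (3 * n + 2)%N = j * (-1) ^+ n * (C0 n.+1 * C1 n.+1 * S1 n)].
Proof.
move=> hj hc C0 C1 S0 S1; have cE := cantor_seqE hc.
have E : j ^+ n * (- j ^+ 2) ^+ n = (-1) ^+ n.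
  by rewrite -exprMn; congr (_ ^+ n); ring: hj.
rewrite {}/C0 {}/C1 {}/S0 {}/S1; split.
- rewrite (@det_hankel_mod3 _ c
    (fun m => 1 * c (1 + m)%N)
    (fun m => - j ^+ 2 * c (1 + m)%N)
    (fun m => j * sum_seq c (0 + m)%N)
    1 _ n n n 1 2 0 j 0 (- j) 0 0 0);
    mod3_blocks hj cE.
  by rewrite !det_hankel_rect; mod3_scalars E hj.
- rewrite (@det_hankel_mod3 _ c
    (fun m => j * c (0 + m)%N)
    (fun m => 1 * c (1 + m)%N)
    (fun m => - j ^+ 2 * sum_seq c (1 + m)%N)
    1 _ n.+1 n n 0 1 2 0 (j ^+ 2) j 0 1 0);
    mod3_blocks hj cE.
  by rewrite !det_hankel_rect; mod3_scalars E hj.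
- rewrite (@det_hankel_mod3 _ c
    (fun m => j * c (0 + m)%N)
    (fun m => 1 * c (1 + m)%N)
    (fun m => - j ^+ 2 * sum_seq c (1 + m)%N)
    1 _ n.+1 n.+1 n 0 1 2 0 (j ^+ 2) j 0 1 0);
    mod3_blocks hj cE.
  by rewrite !det_hankel_rect; mod3_scalars E hj.
Qed.

(** As 1 + j = -j^2, the matrix is [[-j^2, j, t], [j, t, -j^2 t], [t, -j^2 t, j t]]. *)
Lemma det_hankel_s0_mod3 (R : comNzRingType) (j : R) (c : nat -> R) (n : nat) :
  j ^+ 2 = - j - 1 -> cantor_seq j c ->
  let C0 n := \det (hankel c 0 n) in
  let C1 n := \det (hankel c 1 n) in
  let S0 n := \det (hankel (sum_seq c) 0 n) in
  let S1 n := \det (hankel (sum_seq c) 1 n) in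
  [/\ S0 (3 * n)%N = (-1) ^+ n * (S0 n ^+ 2 * C1 n),
      S0 (3 * n + 1)%N = - j ^+ 2 * (-1) ^+ n * (C0 n.+1 * S0 n * S1 n)
    & S0 (3 * n + 2)%N = - j ^+ 2 * (-1) ^+ n * (C0 n.+1 * S0 n.+1 * S1 n)].
Proof.
move=> hj hc C0 C1 S0 S1; have cE := cantor_seqE hc.
have E : j ^+ n * (- j ^+ 2) ^+ n = (-1) ^+ n.
  by rewrite -exprMn; congr (_ ^+ n); ring: hj.
rewrite {}/C0 {}/C1 {}/S0 {}/S1; split.
- rewrite (@det_hankel_mod3 _ (sum_seq c)
    (fun m => j * c (1 + m)%N)
    (fun m => - j ^+ 2 * sum_seq c (0 + m)%N)
    (fun m => 1 * sum_seq c (0 + m)%N)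
    0 _ n n n 2 0 1 (j ^+ 2) (- j) (- j ^+ 2) 0 0 0);
    mod3_blocks hj cE.
  by rewrite !det_hankel_rect; mod3_scalars E hj.
- rewrite (@det_hankel_mod3 _ (sum_seq c)
    (fun m => - j ^+ 2 * c (0 + m)%N)
    (fun m => 1 * sum_seq c (0 + m)%N)
    (fun m => j * sum_seq c (1 + m)%N)
    0 _ n.+1 n n 0 1 2 (- j ^+ 2) (- j) 0 0 1 0);
    mod3_blocks hj cE.
  by rewrite !det_hankel_rect; mod3_scalars E hj.
- rewrite (@det_hankel_mod3 _ (sum_seq c)
    (fun m => - j ^+ 2 * c (0 + m)%N)
    (fun m => 1 * sum_seq c (0 + m)%N)
    (fun m => j * sum_seq c (1 + m)%N)
    0 _ n.+1 n.+1 n 0 1 2 (- j ^+ 2) (- j) 0 0 1 0);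
    mod3_blocks hj cE.
  by rewrite !det_hankel_rect; mod3_scalars E hj.
Qed.

(** The matrix is [[j, t, -j^2 t], [t, -j^2 t, j t], [-j^2 t, j t, t^2]]. *)
Lemma det_hankel_s1_mod3 (R : comNzRingType) (j : R) (c : nat -> R) (n : nat) :
  j ^+ 2 = - j - 1 -> cantor_seq j c ->
  let C0 n := \det (hankel c 0 n) in
  let C1 n := \det (hankel c 1 n) in
  let S0 n := \det (hankel (sum_seq c) 0 n) in
  let S1 n := \det (hankel (sum_seq c) 1 n) in
  [/\ S1 (3 * n)%N = (-1) ^+ n * (S0 n * C1 n * S1 n),
      S1 (3 * n + 1)%N = j * (-1) ^+ n * (C0 n.+1 * S1 n ^+ 2)
    & S1 (3 * n + 2)%N = - (-1) ^+ n * (S0 n.+1 * C1 n.+1 * S1 n)].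
Proof.
move=> hj hc C0 C1 S0 S1; have cE := cantor_seqE hc.
have E : j ^+ n * (- j ^+ 2) ^+ n = (-1) ^+ n.
  by rewrite -exprMn; congr (_ ^+ n); ring: hj.
rewrite {}/C0 {}/C1 {}/S0 {}/S1; split.
- rewrite (@det_hankel_mod3 _ (sum_seq c)
    (fun m => - j ^+ 2 * c (1 + m)%N)
    (fun m => j * sum_seq c (0 + m)%N)
    (fun m => 1 * sum_seq c (1 + m)%N)
    1 _ n n n 1 0 2 (- j) (- j ^+ 2) 0 0 0 0);
    mod3_blocks hj cE.
  by rewrite !det_hankel_rect; mod3_scalars E hj.
(* Residue 0 alone has n + 1 indices, so it leads, with multipliers j^2 t and -j t. *)
- rewrite (@det_hankel_mod3 _ (sum_seq c)
    (fun m => j * c (0 + m)%N)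
    (fun m => - j ^+ 2 * sum_seq c (1 + m)%N)
    (fun m => 1 * sum_seq c (1 + m)%N)
    1 _ n.+1 n n 0 1 2 (j ^+ 2) (- j) (- j ^+ 2) 1 1 0);
    mod3_blocks hj cE.
  by rewrite !det_hankel_rect; mod3_scalars E hj.
- rewrite (@det_hankel_mod3 _ (sum_seq c)
    (fun m => - j ^+ 2 * c (1 + m)%N)
    (fun m => j * sum_seq c (0 + m)%N)
    (fun m => 1 * sum_seq c (1 + m)%N)
    1 _ n.+1 n.+1 n 1 0 2 (- j) (- j ^+ 2) 0 0 0 0);
    mod3_blocks hj cE.
  by rewrite !det_hankel_rect; mod3_scalars E hj.
Qed.

(** * Duality between the determinants of c and s, and the conclusion *)

(** Strong induction on n = 3q + r: the reductions turn each product into a monomial in the same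
    products at q and q + 1. *)
Lemma det_hankel_duality (R : comNzRingType) (j : R) (c : nat -> R) (n : nat) :
  j ^+ 2 = - j - 1 -> c 0%N = 1 -> cantor_seq j c ->
  \det (hankel c 1 n) * \det (hankel (sum_seq c) 0 n) = (-1) ^+ n /\
  \det (hankel c 0 n.+1) * \det (hankel (sum_seq c) 1 n) = (-1) ^+ n.
Proof.
move=> hj hc0 hc; elim/ltn_ind: n => n IHn.
have [->|n0] := posnP n.
  by rewrite !det_mx00 det_mx11 mxE hc0 !mulr1.
have sgn3 k m : (-1) ^+ (3 * k + m) = (-1) ^+ k * (-1) ^+ m :> R.
  by rewrite exprD exprM; congr (_ ^+ _ * _); ring.
set q := (n %/ 3)%N.
have [qn rn] : (q < n)%N /\ n = (3 * q + n %% 3)%N.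
  by rewrite /q mulnC -divn_eq ltn_Pdiv.
have [X Y] := IHn q qn.
have e2 : (-1) ^+ q * (-1) ^+ q = 1 :> R by rewrite -expr2 sqrr_sign.
have [c00 c01 c02] := det_hankel_c0_mod3 q hj hc.
have [c10 c11 c12] := det_hankel_c1_mod3 q hj hc.
have [s00 s01 s02] := det_hankel_s0_mod3 q hj hc.
have [s10 s11 s12] := det_hankel_s1_mod3 q hj hc.
have := ltn_mod n 3; move: rn; case: (n %% 3)%N => [|[|[|//]]] rn _.
- rewrite rn sgn3 addn0 -[(3 * q).+1]addn1 c10 s00 c01 s10.
  by split; ring: X Y e2.
- rewrite rn sgn3 -addnS c11 s01 c02 s11.
  by split; ring: X Y e2 hj.
(* For r = 2 factors of order q + 1 appear, and q + 1 < 3q + 2 allows the induction hypothesis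
   there. *)
have [X1 _] : _ /\ _ := IHn q.+1 ltac:(lia).
have [c30 _ _] := det_hankel_c0_mod3 q.+1 hj hc.
have -> : n.+1 = (3 * q.+1)%N by lia.
rewrite {}rn sgn3 c12 s02 c30 s12 (exprS _ q).
rewrite exprS in X1.
by split; ring: X1 Y e2 hj.
Qed.

Theorem theorem1p2 (C : numClosedFieldType) (c : nat -> C)
    (hc : is_infinite_product (cantor_factor C) c) (n : nat) :
  [/\ \det (hankel (sum_seq c) 0 0) = 1,
      \det (hankel (sum_seq c) 0 (3 * n)) = \det (hankel (sum_seq c) 0 n),
      \det (hankel (sum_seq c) 0 (3 * n + 1)) =
        - J C ^+ 2 * \det (hankel (sum_seq c) 0 n) &
      \det (hankel (sum_seq c) 0 (3 * n + 2)) =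
        - J C ^+ 2 * \det (hankel (sum_seq c) 0 n.+1)] /\
  [/\ \det (hankel (sum_seq c) 1 0) = 1,
      \det (hankel (sum_seq c) 1 (3 * n)) = \det (hankel (sum_seq c) 1 n),
      \det (hankel (sum_seq c) 1 (3 * n + 1)) =
        J C * \det (hankel (sum_seq c) 1 n) &
      \det (hankel (sum_seq c) 1 (3 * n + 2)) =
        \det (hankel (sum_seq c) 1 n)].
Proof.
have hj := J_root C; have [hc0 hrec] := cantor_recurrence hc.
have e2 : (-1) ^+ n * (-1) ^+ n = 1 :> C by rewrite -expr2 sqrr_sign.
have [X Y] := det_hankel_duality n hj hc0 hrec.
(* Order n + 1 serves the case 3n + 2 at index 1, whose reduction contains S0 (n+1) C1 (n+1). *)
have [X1 _] := det_hankel_duality n.+1 hj hc0 hrec.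
rewrite exprS in X1.
have [s00 s01 s02] := det_hankel_s0_mod3 n hj hrec.
have [s10 s11 s12] := det_hankel_s1_mod3 n hj hrec.
rewrite !det_mx00 s00 s01 s02 s10 s11 s12.
by split; split=> //; ring: X Y X1 e2.
Qed.
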